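(* (a) For every integer $k>3$ there is a unique minimal $(k,3)$-quadrocrucial permutation. (b) There are exactly four minimal $(3,3)$-quadrocrucial permutations. (c) For all integers $k,\ell>3$ there are exactly $1+\delta_{k,\ell}$ minimal $(k,\ell)$-quadrocrucial permutations, where $\delta_{k,\ell}$ is the Kronecker delta.
   Context: $i_m=12\cdots m$ and $d_m=m(m-1)\cdots 1$; a permutation (in one-line notation) contains $i_m$ (resp. $d_m$) if it has an increasing (resp. decreasing) subsequence of length $m$, and avoids it otherwise. For $1\le t\le n+1$ put $e_t(x)=x$ if $x<t$ and $e_t(x)=x+1$ if $x\ge t$. The extensions of a permutation $\sigma=\sigma_1\cdots\sigma_n$ of $\{1,\ldots,n\}$ ($n\ge1$) to the right are $e_t(\sigma_1)\cdots e_t(\sigma_n)\,t$, to the left are $t\,e_t(\sigma_1)\cdots e_t(\sigma_n)$, from above are $\sigma_1\cdots\sigma_{t-1}(n+1)\sigma_t\cdots\sigma_n$, and from below are $(\sigma_1+1)\cdots(\sigma_{t-1}+1)\,1\,(\sigma_t+1)\cdots(\sigma_n+1)$, in each case for $1\le t\le n+1$. A permutation is $(k,\ell)$-quadrocrucial if it avoids $i_k$ and $d_\ell$ but each of its extensions to the right, to the left, from above and from below contains $i_k$ or $d_\ell$. Such a permutation is minimal if there is no $(k,\ell)$-quadrocrucial permutation (same $k,\ell$) of smaller length. *)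

(* Defs.v *)
From mathcomp Require Import all_boot.

Set Implicit Arguments.
Unset Strict Implicit.
Unset Printing Implicit Defensive.

(* Permutations of {1, ..., n} are handled in one-line notation, as words
   w : seq nat, so that permutations of all lengths live in one type. *)
Definition is_permutation (w : seq nat) : Prop :=
  0 < size w /\ perm_eq w (iota 1 (size w)).

Definition contains_incr (m : nat) (w : seq nat) : Prop :=
  exists v : seq nat, [/\ subseq v w, size v = m & sorted ltn v].

Definition contains_decr (m : nat) (w : seq nat) : Prop :=
  exists v : seq nat, [/\ subseq v w, size v = m & sorted gtn v].

Definition contains_either (k l : nat) (w : seq nat) : Prop :=
  contains_incr k w \/ contains_decr l w.

Definition shift_from (t x : nat) : nat := if x < t then x else x.+1.

(* In the four extensions t is 1-based and meant to range over
   1 <= t <= (size w).+1; take t.-1 w is then w_1 ... w_(t-1). *)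
Definition ext_right (w : seq nat) (t : nat) : seq nat :=
  rcons (map (shift_from t) w) t.

Definition ext_left (w : seq nat) (t : nat) : seq nat :=
  t :: map (shift_from t) w.

Definition ext_above (w : seq nat) (t : nat) : seq nat :=
  take t.-1 w ++ (size w).+1 :: drop t.-1 w.

Definition ext_below (w : seq nat) (t : nat) : seq nat :=
  map S (take t.-1 w) ++ 1 :: map S (drop t.-1 w).

Definition quadrocrucial (k l : nat) (w : seq nat) : Prop :=
  [/\ is_permutation w,
      ~ contains_incr k w,
      ~ contains_decr l w
    & forall t : nat, 1 <= t <= (size w).+1 ->
        [/\ contains_either k l (ext_right w t),
            contains_either k l (ext_left w t),
            contains_either k l (ext_above w t)
          & contains_either k l (ext_below w t)]].

Definition minimal_quadrocrucial (k l : nat) (w : seq nat) : Prop :=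
  quadrocrucial k l w /\
  forall v : seq nat, quadrocrucial k l v -> ~ (size v < size w).

Definition exactly (c : nat) (P : seq nat -> Prop) : Prop :=
  exists s : seq (seq nat),
    [/\ uniq s, size s = c & forall w : seq nat, w \in s <-> P w].

(* Main.v *)
Require Import Defs.
From mathcomp Require Import all_boot zify.

(* Write k = p + 1 and l = q + 1, and regard a permutation as a set of points
   with a horizontal order x and a vertical order y.  It is quadrocrucial iff it
   avoids i_k and d_l and there are increasing p-chains I1, ..., I4 and
   decreasing q-chains D1, ..., D4 such that I1 is weakly below D1, D2 weakly
   below I2, I3 weakly left of D3 and D4 weakly left of I4.
   If I1 and I2 meet then D2 lies weakly below D1 and they are disjoint, for a
   common point would make their union a decreasing chain of length 2q - 1.
   An increasing and a decreasing chain share at most one point, so there are at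
   least 2q + p - 2 points.  In case of equality the p - 2 points outside
   D1 and D2 belong to every increasing p-chain and lie vertically between D2
   and D1.  The other cases give at least 2p + q - 2 or 2p + 2q - 4 points.  The
   horizontal conditions are treated alike, and for p >= q, p > 2 comparing the
   two decompositions forces D4 = D2 and D3 = D1, hence the permutation
     q ... 1 (q+1) ... (q+p-2) (2q+p-2) ... (q+p-1)
   or, when p = q, its reversal.  The case k = l = 3 is a finite computation. *)

Set Implicit Arguments.
Unset Strict Implicit.
Unset Printing Implicit Defensive.

(** * Chains for a pair of linear orders *)

Definition conv (T : Type) (r : rel T) : rel T := fun i j => r j i.

Definition strict_total (T : eqType) (r : rel T) : Prop :=
  [/\ irreflexive r, transitive r & forall i j, i != j -> r i j || r j i].

(** One implication is enough: for strict total orders it forces [x] and [y] to agree on [A]. *)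
Definition mono (T : finType) (x y : rel T) (A : {set T}) : bool :=
  [forall i in A, forall j in A, x i j ==> y i j].

(** Weak comparison: the two sets may share a point, but only one when [z] is a strict total
    order. *)
Definition below (T : finType) (z : rel T) (A B : {set T}) : bool :=
  [forall i in A, forall j in B, ~~ z j i].

(* Decreasing chains are encoded as mono x (conv y).  With z = y this says that
   there is no extension to the right and to the left, with z = x that there is
   none from above and from below. *)
Definition crossing (T : finType) (x y z : rel T) (p q : nat) : Prop :=
  (exists I D : {set T}, [/\ mono x y I, #|I| = p, mono x (conv y) D, #|D| = q
                           & below z I D]) /\
  (exists I D : {set T}, [/\ mono x y I, #|I| = p, mono x (conv y) D, #|D| = q
                           & below z D I]).

(** The outcome of the case where [I1] and [I2] meet. With [conv y] for [y] and the two kinds of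
    chains exchanged it also serves the case where [D1] and [D2] meet. *)
Definition layered (T : finType) (x y : rel T) (p q : nat)
    (I1 I2 D1 D2 : {set T}) : Prop :=
  [/\ [/\ mono x y I1, #|I1| = p, mono x y I2 & #|I2| = p],
      [/\ mono x (conv y) D1, #|D1| = q, mono x (conv y) D2 & #|D2| = q],
      below y I1 D1, below y D2 I2 & [disjoint D1 & D2]].

Lemma monoP (T : finType) (x y : rel T) (A : {set T}) :
  reflect {in A &, forall i j, x i j -> y i j} (mono x y A).
Proof.
apply: (iffP forall_inP) => h i; last first.
  by move=> iA; apply/forall_inP => j jA; apply/implyP; apply: h.
by move=> j iA jA; apply/implyP; move/forall_inP: (h i iA); apply.
Qed.

Lemma belowP (T : finType) (z : rel T) (A B : {set T}) :
  reflect {in A & B, forall i j, ~~ z j i} (below z A B).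
Proof.
apply: (iffP forall_inP) => h i; last by move=> iA; apply/forall_inP => j; apply: h.
by move=> j iA; move/forall_inP: (h i iA); apply.
Qed.

Lemma strict_total_conv (T : eqType) (r : rel T) :
  strict_total r -> strict_total (conv r).
Proof.
case=> irr tr tot; split=> [i|j i k ji kj|i j /tot]; first exact: irr.
- by apply: tr kj ji.
- by rewrite orbC.
Qed.

Lemma strict_asym (T : eqType) (r : rel T) i j :
  strict_total r -> r i j -> r j i -> False.
Proof. by case=> irr tr _ ij ji; have := tr _ _ _ ij ji; rewrite irr. Qed.

Lemma strict_neg (T : eqType) (r : rel T) i j :
  strict_total r -> ~~ r i j -> i != j -> r j i.
Proof. by case=> _ _ tot nij /tot /orP[|//]; rewrite (negbTE nij). Qed.

Lemma strict_anti (T : eqType) (r : rel T) i j :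
  strict_total r -> ~~ r i j -> ~~ r j i -> i = j.
Proof.
move=> tr nij nji; apply/eqP/negPn/negP => /(strict_neg tr nij).
by rewrite (negbTE nji).
Qed.

Lemma mono_transpose (T : finType) (x y : rel T) (A : {set T}) :
  strict_total x -> strict_total y -> mono x y A -> mono y x A.
Proof.
move=> tx ty /monoP h; apply/monoP => i j iA jA yij.
apply: (strict_neg tx).
  by apply/negP => /(h _ _ jA iA); apply: (strict_asym ty yij).
by apply: contraTneq yij => ->; case: ty => ->.
Qed.

Lemma mono_conv (T : finType) (x y : rel T) (A : {set T}) :
  mono x y A -> mono (conv x) (conv y) A.
Proof. by move=> /monoP h; apply/monoP => i j iA jA; apply: h. Qed.

Lemma mono_transpose_conv (T : finType) (x y : rel T) (A : {set T}) :
  strict_total x -> strict_total y -> mono x (conv y) A -> mono y (conv x) A.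
Proof.
move=> tx ty /(mono_transpose tx (strict_total_conv ty)).
exact: mono_conv.
Qed.

Lemma subset_mono (T : finType) (x y : rel T) (A B : {set T}) :
  A \subset B -> mono x y B -> mono x y A.
Proof.
move=> /subsetP sAB /monoP h; apply/monoP => i j iA jA; apply: h; exact: sAB.
Qed.

(** Two common points would be compared by [y] in both directions. *)
Lemma card_mono_conv (T : finType) (x y : rel T) (A B : {set T}) :
  strict_total x -> strict_total y -> mono x y A -> mono x (conv y) B ->
  #|A :&: B| <= 1.
Proof.
move=> tx ty /monoP hA /monoP hB; rewrite leqNgt; apply/negP => /card_gt1P[i [j [/setIP[iA iB] /setIP[jA jB] ij]]].
have [_ _ tot] := tx.
by case/orP: (tot _ _ ij) => h; apply: (strict_asym ty (hA _ _ _ _ h) (hB _ _ _ _ h)).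
Qed.

Lemma crossing_transpose (T : finType) (x y z : rel T) p q :
  strict_total x -> strict_total y -> crossing x y z p q -> crossing y x z p q.
Proof.
move=> tx ty [[I [D [h1 h2 h3 h4 h5]]] [I' [D' [k1 k2 k3 k4 k5]]]].
split; [exists I, D | exists I', D']; split=> //;
  by [apply: mono_transpose | apply: mono_transpose_conv].
Qed.

(* If z lies in I1 and I2 then D2 <= z <= D1 in the order y, so z is the only
   possible common point of D1 and D2. *)
Lemma meet_disjoint (T : finType) (x y : rel T) (q : nat)
    (I1 I2 D1 D2 : {set T}) :
  strict_total x -> strict_total y -> 1 < q ->
  (forall A : {set T}, mono x (conv y) A -> #|A| <= q) ->
  mono x (conv y) D1 -> #|D1| = q -> mono x (conv y) D2 -> #|D2| = q ->
  below y I1 D1 -> below y D2 I2 -> ~~ [disjoint I1 & I2] ->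
  [disjoint D1 & D2].
Proof.
move=> tx ty q1 maxq dD1 cD1 dD2 cD2 /belowP b1 /belowP b2.
case/pred0Pn => z /= /andP[zI1 zI2].
apply/pred0P => c /=; apply/negP => /andP[cD1' cD2'].
have cz : c = z by apply: (strict_anti ty); [apply: b1 | apply: b2].
subst c.
have sub : D1 :&: D2 \subset [set z].
  apply/subsetP => d /setIP[d1 d2]; rewrite inE; apply/eqP.
  by apply: (strict_anti ty); [apply: b1 | apply: b2].
(* Now [z] lies in both [D1] and [D2]. The rest of [D1] is to the upper left of [z], the rest of
   [D2] to the lower right. *)
have lt1 d : d \in D1 -> d != z -> x d z /\ y z d.
  move=> dD dz; have yzd : y z d by apply: (strict_neg ty) => //; apply: b1.
  split=> //; apply: (strict_neg tx); last by rewrite eq_sym.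
  apply/negP => xzd; apply: (strict_asym ty yzd).
  by move/monoP: dD1 => /(_ z d); apply.
have lt2 d : d \in D2 -> d != z -> x z d /\ y d z.
  move=> dD dz.
  have ydz : y d z by apply: (strict_neg ty); [apply: b2 | rewrite eq_sym].
  split=> //; apply: (strict_neg tx) => //.
  apply/negP => xdz; apply: (strict_asym ty ydz).
  by move/monoP: dD2 => /(_ d z); apply.
have [_ trx _] := tx; have [_ try _] := ty.
have m12 : mono x (conv y) (D1 :|: D2).
  have cross i j : i \in D1 -> j \in D2 ->
      (x i j -> conv y i j) /\ (x j i -> conv y j i).
    move=> iD jD.
    have [->|iz] := eqVneq i z.
      by move/monoP: dD2 => m; split; apply: m.
    have [->|jz] := eqVneq j z.
      by move/monoP: dD1 => m; split; apply: m.
    have [xiz yzi] := lt1 _ iD iz; have [xzj yjz] := lt2 _ jD jz.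
    split=> [_|xji]; first exact: try yjz yzi.
    by case: (strict_asym tx (trx _ _ _ xiz xzj) xji).
  apply/monoP => i j /setUP[iD|iD] /setUP[jD|jD].
  - by move/monoP: dD1; apply.
  - by case: (cross i j).
  - by case: (cross j i).
  - by move/monoP: dD2; apply.
(* The union has at least 2q - 1 points, which exceeds q because q > 1. *)
have := maxq _ m12; rewrite cardsU cD1 cD2.
have := subset_leq_card sub; rewrite cards1; lia.
Qed.

Lemma card_meet_le2 (T : finType) (x y : rel T) (I D1 D2 : {set T}) :
  strict_total x -> strict_total y -> mono x y I ->
  mono x (conv y) D1 -> mono x (conv y) D2 ->
  #|I :&: (D1 :|: D2)| <= 2.
Proof.
move=> tx ty mI m1 m2; rewrite setIUr cardsU.
have := card_mono_conv tx ty mI m1; have := card_mono_conv tx ty mI m2; lia.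
Qed.

(** [I1] shares at most one point with each of the disjoint chains [D1] and [D2], so the three cover
    at least p + 2q - 2 points. *)
Lemma layered_leq (T : finType) (x y : rel T) p q (I1 I2 D1 D2 : {set T}) :
  strict_total x -> strict_total y -> layered x y p q I1 I2 D1 D2 ->
  p + 2 * q <= #|T| + 2.
Proof.
move=> tx ty [[m1 c1 _ _] [n1 d1 n2 d2] _ _ dis].
have := card_meet_le2 tx ty m1 n1 n2.
have := max_card (mem (I1 :|: (D1 :|: D2))).
have : #|D1 :&: D2| = 0 by apply/eqP; rewrite cards_eq0 setI_eq0.
rewrite !cardsU; lia.
Qed.

Lemma crossing_cases (T : finType) (x y : rel T) p q :
  strict_total x -> strict_total y -> 1 < p -> 1 < q ->
  (forall A : {set T}, mono x (conv y) A -> #|A| <= q) ->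
  crossing x y y p q ->
  [\/ exists I1 I2 D1 D2 : {set T}, layered x y p q I1 I2 D1 D2,
      exists I1 I2 D1 D2 : {set T}, layered x (conv y) q p I1 I2 D1 D2
    | 2 * p + 2 * q <= #|T| + 4].
Proof.
move=> tx ty p1 q1 maxq.
move=> [[I1 [D1 [mI1 cI1 mD1 cD1 b1]]] [I2 [D2 [mI2 cI2 mD2 cD2 b2]]]].
have [disI|meet] := boolP [disjoint I1 & I2]; last first.
  constructor 1; exists I1, I2, D1, D2; split=> //.
  exact: (meet_disjoint tx ty q1 maxq mD1 cD1 mD2 cD2 b1 b2 meet).
(* Here [I1] and [I2] are disjoint. If [D1] and [D2] meet, reversing [y] exchanges the two kinds of
   chains, and [disI] is the disjointness that [layered] asks for. *)
have [disD|meet] := boolP [disjoint D1 & D2]; last first.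
  constructor 2; exists D1, D2, I1, I2; split=> //.
  - by apply/belowP => i j iD jI; move/belowP: b1 => /(_ j i jI iD).
  - by apply/belowP => i j iD jI; move/belowP: b2 => /(_ j i jI iD).
(* Both pairs are disjoint: 2p points on increasing chains, 2q on decreasing ones, at most four in
   common. *)
constructor 3.
have := card_meet_le2 tx ty mI1 mD1 mD2; have := card_meet_le2 tx ty mI2 mD1 mD2.
have := max_card (mem ((I1 :|: I2) :|: (D1 :|: D2))).
have : #|D1 :&: D2| = 0 by apply/eqP; rewrite cards_eq0 setI_eq0.
have : #|I1 :&: I2| = 0 by apply/eqP; rewrite cards_eq0 setI_eq0.
rewrite (cardsU (I1 :|: I2)) setIUl (cardsU I1) (cardsU D1).
rewrite (cardsU (I1 :&: _)); lia.
Qed.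

(** Equality leaves p - 2 points outside [D1] and [D2], and [J] has at most one point in each of
    these. To reach p points it must use all of them. *)
Lemma layered_chain (T : finType) (x y : rel T) p q (I1 I2 D1 D2 J : {set T}) :
  strict_total x -> strict_total y -> layered x y p q I1 I2 D1 D2 ->
  p + 2 * q = #|T| + 2 -> mono x y J -> #|J| = p ->
  [/\ ~: (D1 :|: D2) \subset J, J :&: D1 != set0 & J :&: D2 != set0].
Proof.
move=> tx ty [_ [n1 d1 n2 d2] _ _ dis] cT mJ cJ.
have e0 : #|D1 :&: D2| = 0 by apply/eqP; rewrite cards_eq0 setI_eq0.
have cU : #|D1 :|: D2| = 2 * q by rewrite cardsU; lia.
have cM := cardsC (D1 :|: D2).
have k1 := card_mono_conv tx ty mJ n1; have k2 := card_mono_conv tx ty mJ n2.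
have k3 : #|J :&: (D1 :|: D2)| <= #|J :&: D1| + #|J :&: D2|.
  by rewrite setIUr cardsU leq_subr.
have k4 := cardsID (D1 :|: D2) J.
have sub : J :\: (D1 :|: D2) \subset ~: (D1 :|: D2).
  by rewrite setDE subsetIr.
have k5 := subset_leq_card sub.
split; last 2 first.
- rewrite -card_gt0; lia.
- rewrite -card_gt0; lia.
have : J :\: (D1 :|: D2) == ~: (D1 :|: D2) by rewrite eqEcard sub; lia.
by move=> /eqP <-; rewrite subsetDl.
Qed.

(** Both [I1] and [I2] contain every point outside [D1] and [D2], which puts these points above [D2]
    and below [D1]. As p > 2 there is such a point, and through it [D2] lies below [D1]. *)
Lemma layered_order (T : finType) (x y : rel T) p q (I1 I2 D1 D2 : {set T}) :
  strict_total x -> strict_total y -> layered x y p q I1 I2 D1 D2 ->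
  p + 2 * q = #|T| + 2 -> 2 < p ->
  [/\ mono x y (~: (D1 :|: D2)), ~: (D1 :|: D2) != set0,
      {in D2 & ~: (D1 :|: D2), forall i j, y i j},
      {in ~: (D1 :|: D2) & D1, forall i j, y i j}
    & {in D2 & D1, forall i j, y i j}].
Proof.
move=> tx ty lay cT p2.
have [[m1 c1 m2 c2] [n1 d1 n2 d2] /belowP b1 /belowP b2 dis] := lay.
have [s1 _ _] := layered_chain tx ty lay cT m1 c1.
have [s2 _ _] := layered_chain tx ty lay cT m2 c2.
have [_ try _] := ty.
have e0 : #|D1 :&: D2| = 0 by apply/eqP; rewrite cards_eq0 setI_eq0.
have cU : #|D1 :|: D2| = 2 * q by rewrite cardsU; lia.
have cM := cardsC (D1 :|: D2).
have M0 : ~: (D1 :|: D2) != set0 by rewrite -card_gt0; lia.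
have o1 : {in D2 & ~: (D1 :|: D2), forall i j, y i j}.
  move=> i j iD jM; apply: (strict_neg ty); first by apply: b2 => //; apply: (subsetP s2).
  by apply: contraTneq jM => ->; rewrite !inE iD orbT.
have o2 : {in ~: (D1 :|: D2) & D1, forall i j, y i j}.
  move=> i j iM jD; apply: (strict_neg ty); first by apply: b1 => //; apply: (subsetP s1).
  by apply: contraTneq iM => <-; rewrite !inE jD.
split=> //; first exact: subset_mono s1 m1.
move=> i j iD jD; have /set0Pn[m mM] := M0.
exact: try (o1 _ _ iD mM) (o2 _ _ mM jD).
Qed.

(** The two decompositions leave the same points outside. A common point of [D1] and [D4] could then
    be added to [D2], giving a decreasing chain longer than q. *)
Lemma layered_rigid (T : finType) (x y : rel T) p q
    (I1 I2 D1 D2 I3 I4 D3 D4 : {set T}) :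
  strict_total x -> strict_total y -> p + 2 * q = #|T| + 2 -> 2 < p ->
  (forall A : {set T}, mono x (conv y) A -> #|A| <= q) ->
  layered x y p q I1 I2 D1 D2 -> layered y x p q I3 I4 D3 D4 ->
  D3 = D1 /\ D4 = D2.
Proof.
move=> tx ty cT p2 maxq l1 l2.
have [[m1 c1 m2 c2] [n1 d1 n2 d2] /belowP b1 /belowP b2 dis] := l1.
have [[m3 c3 m4 c4] [n3 d3 n4 d4] _ _ dis'] := l2.
have [_ M0 oDM oMD oDD] := layered_order tx ty l1 cT p2.
have [_ _ oDM' oMD' oDD'] := layered_order ty tx l2 cT p2.
have [s1 k13 k14] := layered_chain ty tx l2 cT (mono_transpose tx ty m1) c1.
have [s2 k23 k24] := layered_chain ty tx l2 cT (mono_transpose tx ty m2) c2.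
(* A point e outside [D3] and [D4] lies in [I1] and [I2]. If e were in [D1], a point of [I1] in [D3]
   would be to the right of e and so strictly above it, although [I1] is weakly below [D1]. For [D2]
   the argument uses [I2] and [D4]. *)
have sM : ~: (D3 :|: D4) \subset ~: (D1 :|: D2).
  apply/subsetP => e eM; rewrite inE; apply/negP => /setUP[eD|eD].
    case/set0Pn: k13 => f /setIP[fI fD]; have /negP := b1 _ _ fI eD; apply.
    move/monoP: m1; apply=> //; first exact: (subsetP s1).
    exact: oMD'.
  case/set0Pn: k24 => f /setIP[fI fD]; have /negP := b2 _ _ eD fI; apply.
  move/monoP: m2; apply=> //; first exact: (subsetP s2).
  exact: oDM'.
have e0 : #|D1 :&: D2| = 0 by apply/eqP; rewrite cards_eq0 setI_eq0.
have e0' : #|D3 :&: D4| = 0 by apply/eqP; rewrite cards_eq0 setI_eq0.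
have cU : #|D1 :|: D2| = #|D3 :|: D4|.
  by rewrite (cardsU D1) (cardsU D3) e0 e0' d1 d2 d3 d4.
have eU : D1 :|: D2 = D3 :|: D4.
  by apply/eqP; rewrite eqEcard -setCS sM cU leqnn.
have B0 : D1 :&: D4 = set0.
  apply/eqP; rewrite -cards_eq0.
  (* Each point of [D2] is in [D3] or [D4]; either way it is to the right of every point of
     [D1 :&: D4], and it is below it. *)
  have mB : mono x (conv y) ((D1 :&: D4) :|: D2).
    have cross i j : i \in D1 :&: D4 -> j \in D2 -> x i j /\ y j i.
      move=> /setIP[iD iD4] jD; have yji := oDD _ _ jD iD; split=> //.
      have : j \in D3 :|: D4 by rewrite -eU inE jD orbT.
      case/setUP => jD'; first exact: oDD'.
      by move/monoP: n4 => /(_ j i); apply.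
    apply/monoP => i j /setUP[iD|iD] /setUP[jD|jD].
    - by move/monoP: n1; apply; [case/setIP: iD | case/setIP: jD].
    - by have [_] := cross _ _ iD jD.
    - by have [h _] := cross _ _ jD iD => /(strict_asym tx h).
    - by move/monoP: n2; apply.
  have := maxq _ mB; rewrite cardsU d2.
  rewrite setIAC (_ : D1 :&: D2 = set0); last by apply/eqP; rewrite setI_eq0.
  by rewrite set0I cards0 subn0 -[leqRHS]add0n leq_add2r leqn0.
have eD4 : D4 = D2.
  apply/eqP; rewrite eqEcard d4 d2 leqnn andbT; apply/subsetP => i iD.
  have : i \in D1 :|: D2 by rewrite eU inE iD orbT.
  case/setUP => // iD1; have : i \in D1 :&: D4 by rewrite inE iD1.
  by rewrite B0 inE.
split=> //.
apply/eqP; rewrite eqEcard d3 d1 leqnn andbT; apply/subsetP => i iD.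
have : i \in D1 :|: D2 by rewrite eU inE iD.
case/setUP => // iD2; move: dis'; rewrite -setI_eq0 => /eqP /setP /(_ i).
by rewrite !inE iD eD4 iD2.
Qed.

(** The two bounds express avoidance of increasing chains of length p + 1 and decreasing ones of
    length q + 1. *)
Definition config (T : finType) (x y : rel T) (p q : nat) : Prop :=
  [/\ strict_total x /\ strict_total y,
      forall A : {set T}, mono x y A -> #|A| <= p,
      forall A : {set T}, mono x (conv y) A -> #|A| <= q,
      crossing x y y p q & crossing x y x p q].

(** The direct sum of a decreasing block [D2], an increasing block [M] and a decreasing block
    [D1]. *)
Definition layout (T : finType) (x y : rel T) (q : nat) : Prop :=
  exists D1 D2 : {set T}, let M := ~: (D1 :|: D2) in
  [/\ [/\ mono x (conv y) D1, #|D1| = q, mono x (conv y) D2 & #|D2| = q],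
      mono x y M,
      [/\ {in D2 & M, forall i j, x i j}, {in M & D1, forall i j, x i j}
        & {in D2 & D1, forall i j, x i j}]
    & [/\ {in D2 & M, forall i j, y i j}, {in M & D1, forall i j, y i j}
        & {in D2 & D1, forall i j, y i j}]].

Lemma layered_layout (T : finType) (x y : rel T) p q
    (I1 I2 D1 D2 I3 I4 D3 D4 : {set T}) :
  strict_total x -> strict_total y -> p + 2 * q = #|T| + 2 -> 2 < p ->
  (forall A : {set T}, mono x (conv y) A -> #|A| <= q) ->
  layered x y p q I1 I2 D1 D2 -> layered y x p q I3 I4 D3 D4 ->
  layout x y q.
Proof.
move=> tx ty cT p2 maxq l1 l2; exists D1, D2.
have [e3 e4] := layered_rigid tx ty cT p2 maxq l1 l2.
have [mM _ o1 o2 o3] := layered_order tx ty l1 cT p2.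
have [_ _ o4 o5 o6] := layered_order ty tx l2 cT p2.
rewrite e3 e4 in o4 o5 o6; case: l1 => _ n12 _ _ _.
by split.
Qed.

(** A half turn exchanges top and bottom. It turns a layering for [y] and [conv x] into one for
    [conv y] and [x], which can be compared with one for [x] and [conv y]. *)
Lemma layered_conv (T : finType) (x y : rel T) p q (I1 I2 D1 D2 : {set T}) :
  layered x y p q I1 I2 D1 D2 -> layered (conv x) (conv y) p q I2 I1 D2 D1.
Proof.
move=> [[m1 c1 m2 c2] [n1 d1 n2 d2] /belowP b1 /belowP b2 dis].
split; first by split=> //; apply: mono_conv.
- by split=> //; apply: mono_conv.
- by apply/belowP => i j iI jD; apply: b2.
- by apply/belowP => i j iI jD; apply: b1.
- by rewrite disjoint_sym.
Qed.

Lemma config_cases (T : finType) (x y : rel T) p q :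
  config x y p q -> 1 < p -> 1 < q ->
  [\/ exists I1 I2 D1 D2 : {set T}, layered x y p q I1 I2 D1 D2,
      exists I1 I2 D1 D2 : {set T}, layered x (conv y) q p I1 I2 D1 D2
    | 2 * p + 2 * q <= #|T| + 4].
Proof.
by case=> [[tx ty] _ maxq cy _] p1 q1; apply: crossing_cases.
Qed.

Lemma config_transpose (T : finType) (x y : rel T) p q :
  config x y p q -> config y x p q.
Proof.
case=> [[tx ty] maxp maxq cy cx]; split=> //.
- by move=> A /(mono_transpose ty tx); apply: maxp.
- by move=> A /(mono_transpose_conv ty tx); apply: maxq.
- exact: crossing_transpose.
- exact: crossing_transpose.
Qed.

(** Among the bounds p + 2q - 2, 2p + q - 2 and 2p + 2q - 4 the first is the smallest. *)
Lemma config_leq (T : finType) (x y : rel T) p q :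
  config x y p q -> 1 < q <= p -> p + 2 * q <= #|T| + 2.
Proof.
move=> cf /andP[q1 qp]; have [[tx ty] _ _ _ _] := cf.
case: (config_cases cf _ q1) => [||[D1 [D2 [I1 [I2 l]]]]|]; try lia.
  by move=> [I1 [I2 [D1 [D2 l]]]]; apply: layered_leq l.
by have := layered_leq tx (strict_total_conv ty) l; lia.
Qed.

(** Both chains contain the nonempty set of points outside [D1] and [D2]. This excludes mixed
    outcomes for the two directions. *)
Lemma layered_disjoint (T : finType) (x y : rel T) p q
    (I1 I2 D1 D2 I3 I4 : {set T}) :
  strict_total x -> strict_total y -> p + 2 * q = #|T| + 2 -> 2 < p ->
  layered x y p q I1 I2 D1 D2 ->
  mono x y I3 -> #|I3| = p -> mono x y I4 -> #|I4| = p ->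
  ~~ [disjoint I3 & I4].
Proof.
move=> tx ty cT p2 l1 m3 c3 m4 c4.
have [_ /set0Pn[m mM] _ _ _] := layered_order tx ty l1 cT p2.
have [/subsetP s3 _ _] := layered_chain tx ty l1 cT m3 c3.
have [/subsetP s4 _ _] := layered_chain tx ty l1 cT m4 c4.
by apply/pred0Pn; exists m => /=; rewrite s3 ?s4.
Qed.

Lemma config_layout (T : finType) (x y : rel T) p q :
  config x y p q -> 1 < q <= p -> 2 < p -> p + 2 * q = #|T| + 2 ->
  layout x y q \/ p = q /\ layout x (conv y) q.
Proof.
move=> cf /andP[q1 qp] p2 cT; have p1 : 1 < p by lia.
have [[tx ty] maxp maxq _ _] := cf.
have [tcx tcy] := (strict_total_conv tx, strict_total_conv ty).
have cf' := config_transpose cf.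
(* A layering with exchanged roles gives q + 2p - 2 <= p + 2q - 2, that is p <= q. *)
have eqpq I1 I2 D1 D2 (r s : rel T) : strict_total r -> strict_total s ->
    layered r (conv s) q p I1 I2 D1 D2 -> p = q.
  by move=> tr /strict_total_conv ts l; have := layered_leq tr ts l; lia.
(* The third alternative would force p <= 2. *)
case: (config_cases cf p1 q1) => [||]; last lia.
- move=> [I1 [I2 [D1 [D2 l1]]]].
  case: (config_cases cf' p1 q1) => [||]; last lia.
    move=> [I3 [I4 [D3 [D4 l2]]]]; left; exact: (layered_layout tx ty cT p2 maxq l1 l2).
  (* Mixed outcome: the other direction supplies two disjoint increasing p-chains. *)
  move=> [D3 [D4 [I3 [I4 [_ [m3 c3 m4 c4] _ _ dis]]]]].
  have /negP[] := layered_disjoint tx ty cT p2 l1 (mono_transpose ty tx m3) c3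
    (mono_transpose ty tx m4) c4.
  by [].
- move=> [D1 [D2 [I1 [I2 l1]]]].
  case: (config_cases cf' p1 q1) => [||]; last lia.
    move=> [I3 [I4 [D3 [D4 l2]]]].
    have [_ [m1 c1 m2 c2] _ _ dis] := l1.
    have /negP[] := layered_disjoint ty tx cT p2 l2 (mono_transpose tx ty m1) c1
      (mono_transpose tx ty m2) c2.
    by [].
  move=> [D3 [D4 [I3 [I4 /layered_conv l2]]]].
  have epq := eqpq _ _ _ _ _ _ tx ty l1; subst q.
  right; split=> //; exact: (layered_layout tx tcy cT p2 maxp l1 l2).
Qed.

(** * Extensions of words *)

(** Convertible with [contains_incr] at [ltn] and with [contains_decr] at [gtn]. *)
Definition cont (e : rel nat) (m : nat) (w : seq nat) : Prop :=
  exists v : seq nat, [/\ subseq v w, size v = m & sorted e v].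

Lemma cont_rev (e : rel nat) m w : cont e m (rev w) <-> cont (conv e) m w.
Proof.
split=> -[v [vw <- sv]]; exists (rev v); split; rewrite ?size_rev //.
- by rewrite -(revK w) subseq_rev.
- by rewrite rev_sorted.
- by rewrite subseq_rev.
- by rewrite rev_sorted.
Qed.

Lemma cont_map (e : rel nat) (f : nat -> nat) m w :
  {mono f : i j / e i j} -> cont e m (map f w) <-> cont e m w.
Proof.
move=> mf; split=> -[v [vw <- sv]].
  case/subseqP: vw sv => b _ ->; rewrite -map_mask => sv.
  exists (mask b w); split; rewrite ?mask_subseq ?size_map //.
  by rewrite (mono_sorted mf) in sv.
by exists (map f v); rewrite size_map map_subseq ?(mono_sorted mf).
Qed.

Lemma cont_insert_last (e : rel nat) m (u1 u2 : seq nat) z :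
  transitive e -> {in u2, forall x, ~~ e z x} ->
  cont e m.+1 (u1 ++ z :: u2) <->
  cont e m.+1 (u1 ++ u2) \/ cont e m [seq x <- u1 | e x z].
Proof.
move=> tr nz; split.
  case=> v [/subseqP[b sb ->] sz sv].
  have sb1 : size (take (size u1) b) = size u1.
    by rewrite size_take sb size_cat /= addnS ltnS leq_addr.
  rewrite -(cat_take_drop (size u1) b) mask_cat // in sz sv.
  (* The bit [c] records whether the subword uses [z]; if not, it is a subword of [u1 ++ u2]. *)
  case: (drop _ b) (size_drop (size u1) b) sz sv => [|c b2] _ sz sv.
    left; exists (mask (take (size u1) b) u1); rewrite cats0 in sz sv.
    by split=> //; apply: subseq_trans (mask_subseq _ _) (prefix_subseq _ _).
  case: c sz sv => /= sz sv; last first.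
    left; eexists; split; [|exact: sz|exact: sv].
    by apply: cat_subseq; apply: mask_subseq.
  move: sv; rewrite sorted_pairwise // pairwise_cat /= allrel_consr.
  case/and4P => /andP[lz _] pw1 zl _.
  have m2 : mask b2 u2 = [::].
    case E: (mask b2 u2) zl => [//|x s] /= /andP[zx _].
    have /nz : x \in u2 by apply: (@mem_mask _ _ b2); rewrite E mem_head.
    by rewrite zx.
  right; exists (mask (take (size u1) b) u1); split.
  - by rewrite subseq_filter lz mask_subseq.
  - by move: sz; rewrite m2 size_cat /= addn1 => -[].
  - by rewrite sorted_pairwise.
case=> [] [v [vu sz sv]].
  exists v; split=> //; apply: subseq_trans vu _.
  by apply: cat_subseq => //; apply: subseq_cons.
move: vu; rewrite subseq_filter => /andP[lz vu].
exists (rcons v z); rewrite size_rcons sz -cats1; split=> //.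
  by apply: cat_subseq => //=; rewrite eqxx sub0seq.
by rewrite sorted_pairwise // pairwise_cat /= allrel1r lz -sorted_pairwise // sv.
Qed.

Lemma cont_insert_first (e : rel nat) m (u1 u2 : seq nat) z :
  transitive e -> {in u1, forall x, ~~ e x z} ->
  cont e m.+1 (u1 ++ z :: u2) <->
  cont e m.+1 (u1 ++ u2) \/ cont e m [seq x <- u2 | e z x].
Proof.
move=> tr nz.
have ctr : transitive (conv e) by move=> j i k ji kj; apply: tr kj ji.
have toconv k w : cont e k w <-> cont (conv e) k (rev w).
  by split=> [h|/cont_rev //]; apply/cont_rev.
have nz' : {in rev u1, forall x, ~~ conv e z x}.
  by move=> x; rewrite mem_rev; apply: nz.
have := cont_insert_last m (rev u2) ctr nz'.
rewrite -cat_rcons -rev_cons -!rev_cat filter_rev.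
have := toconv m.+1 (u1 ++ z :: u2); have := toconv m.+1 (u1 ++ u2).
have := toconv m [seq x <- u2 | e z x]; tauto.
Qed.

Lemma shift_from_mono t : {mono shift_from t : i j / i < j}.
Proof. by move=> i j; rewrite /shift_from; case: (ltnP i t) (ltnP j t) => ? [] ?; lia. Qed.

Lemma cont_map_shift t m w :
  (cont ltn m (map (shift_from t) w) <-> cont ltn m w) /\
  (cont gtn m (map (shift_from t) w) <-> cont gtn m w).
Proof. by split; apply: cont_map => i j /=; rewrite shift_from_mono. Qed.

Lemma cont_map_succ m w :
  (cont ltn m (map S w) <-> cont ltn m w) /\
  (cont gtn m (map S w) <-> cont gtn m w).
Proof. by split; apply: cont_map. Qed.

Lemma filter_shift_lt t w :
  [seq x <- map (shift_from t) w | x < t] = map (shift_from t) [seq x <- w | x < t].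
Proof.
by rewrite filter_map; congr map; apply: eq_filter => x /=; rewrite /shift_from;
case: (ltnP x t); lia.
Qed.

(** The strict bound turns into a weak one because an old entry t is moved to t + 1. *)
Lemma filter_shift_gt t w :
  [seq x <- map (shift_from t) w | t < x] = map (shift_from t) [seq x <- w | t <= x].
Proof.
by rewrite filter_map; congr map; apply: eq_filter => x /=; rewrite /shift_from;
case: (ltnP x t); lia.
Qed.

Lemma gtn_trans : transitive gtn.
Proof. by move=> j i k /= ji kj; apply: ltn_trans kj ji. Qed.

(** The new entry is last, so it can only end a chain, after smaller entries if increasing and after
    larger ones if decreasing. *)
Lemma ext_rightP k l w t :
  contains_either k.+1 l.+1 (ext_right w t) <->
  contains_either k.+1 l.+1 w \/
  (cont ltn k [seq x <- w | x < t] \/ cont gtn l [seq x <- w | t <= x]).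
Proof.
rewrite /contains_either /ext_right -cats1.
have := @cont_insert_last ltn k (map (shift_from t) w) [::] t ltn_trans.
have := @cont_insert_last gtn l (map (shift_from t) w) [::] t gtn_trans.
rewrite /= filter_shift_lt filter_shift_gt cats0.
(* The side condition ranges over the empty suffix. *)
move=> /(_ (fun x h => False_ind _ (notF h))) h1 /(_ (fun x h => False_ind _ (notF h))) h2.
have [_ a1] := cont_map_shift t l.+1 w; have [a2 _] := cont_map_shift t k.+1 w.
have [_ a3] := cont_map_shift t l [seq x <- w | t <= x].
have [a4 _] := cont_map_shift t k [seq x <- w | x < t].
tauto.
Qed.

Lemma ext_leftP k l w t :
  contains_either k.+1 l.+1 (ext_left w t) <->
  contains_either k.+1 l.+1 w \/
  (cont ltn k [seq x <- w | t <= x] \/ cont gtn l [seq x <- w | x < t]).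
Proof.
rewrite /contains_either /ext_left -[_ :: _]cat0s.
have := @cont_insert_first ltn k [::] (map (shift_from t) w) t ltn_trans.
have := @cont_insert_first gtn l [::] (map (shift_from t) w) t gtn_trans.
rewrite /= filter_shift_lt filter_shift_gt.
move=> /(_ (fun x h => False_ind _ (notF h))) h1 /(_ (fun x h => False_ind _ (notF h))) h2.
have [_ a1] := cont_map_shift t l.+1 w; have [a2 _] := cont_map_shift t k.+1 w.
have [a3 _] := cont_map_shift t k [seq x <- w | t <= x].
have [_ a4] := cont_map_shift t l [seq x <- w | x < t].
tauto.
Qed.

(** The new entry is the maximum, so it can only end an increasing chain and begin a decreasing
    one. *)
Lemma ext_aboveP k l w t :
  {in w, forall x, x <= size w} ->
  contains_either k.+1 l.+1 (ext_above w t) <->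
  contains_either k.+1 l.+1 w \/
  (cont ltn k (take t.-1 w) \/ cont gtn l (drop t.-1 w)).
Proof.
move=> le_w; rewrite /contains_either /ext_above.
have := @cont_insert_last ltn k (take t.-1 w) (drop t.-1 w) (size w).+1 ltn_trans.
have := @cont_insert_first gtn l (take t.-1 w) (drop t.-1 w) (size w).+1 gtn_trans.
rewrite cat_take_drop.
have -> : [seq x <- take t.-1 w | ltn x (size w).+1] = take t.-1 w.
  by apply/all_filterP/allP => x /mem_take /le_w.
have -> : [seq x <- drop t.-1 w | gtn (size w).+1 x] = drop t.-1 w.
  by apply/all_filterP/allP => x /mem_drop /le_w.
case=> [x /mem_take /le_w /=|h1 h2]; first by lia.
case=> [x /mem_drop /le_w /=|h3 h4]; first by lia.
tauto.
Qed.

Lemma ext_belowP k l w t :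
  {in w, forall x, 0 < x} ->
  contains_either k.+1 l.+1 (ext_below w t) <->
  contains_either k.+1 l.+1 w \/
  (cont ltn k (drop t.-1 w) \/ cont gtn l (take t.-1 w)).
Proof.
move=> gt_w; rewrite /contains_either /ext_below.
have := @cont_insert_first ltn k (map S (take t.-1 w)) (map S (drop t.-1 w)) 1 ltn_trans.
have := @cont_insert_last gtn l (map S (take t.-1 w)) (map S (drop t.-1 w)) 1 gtn_trans.
rewrite -map_cat cat_take_drop.
have -> : [seq x <- map S (drop t.-1 w) | ltn 1 x] = map S (drop t.-1 w).
  by apply/all_filterP/allP => _ /mapP[x /mem_drop /gt_w gt_x ->].
have -> : [seq x <- map S (take t.-1 w) | gtn x 1] = map S (take t.-1 w).
  by apply/all_filterP/allP => _ /mapP[x /mem_take /gt_w gt_x ->].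
case=> [_ /mapP[x /mem_drop /gt_w gt_x ->] /=|h1 h2]; first by lia.
case=> [_ /mapP[x /mem_take /gt_w gt_x ->] /=|h3 h4]; first by lia.
have [a1 a2] := cont_map_succ k.+1 w; have [a3 a4] := cont_map_succ l.+1 w.
have [a5 _] := cont_map_succ k (drop t.-1 w).
have [_ a6] := cont_map_succ l (take t.-1 w).
tauto.
Qed.

(** * From words to pairs of linear orders *)

Definition ordby (T : Type) (g : T -> nat) : rel T := fun i j => g i < g j.

(** One-based, so that slots and entries of a permutation have the same range and [threshold]
    applies to both. *)
Definition slot (w : seq nat) (i : 'I_(size w)) : nat := i.+1.

Definition entry (w : seq nat) (i : 'I_(size w)) : nat := nth 0 w i.

Lemma strict_total_ordby (T : eqType) (g : T -> nat) :
  injective g -> strict_total (ordby g).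
Proof.
move=> inj; split=> [i|j i k|i j ij]; rewrite /ordby ?ltnn //.
- exact: ltn_trans.
- by rewrite -neq_ltn (inj_eq inj).
Qed.

Lemma strict_total_slot (w : seq nat) : strict_total (ordby (@slot w)).
Proof. by apply: strict_total_ordby => i j [] /val_inj. Qed.

Lemma strict_total_entry (w : seq nat) :
  uniq w -> strict_total (ordby (@entry w)).
Proof.
move=> uw; apply: strict_total_ordby => i j /eqP.
by rewrite nth_uniq // => /eqP /val_inj.
Qed.

(** At [ltn] and [gtn] the relation [relpre (@entry w) e] is convertible with [ordby (@entry w)] and
    its converse. *)
Lemma cont_subword (e : rel nat) m w (Q : pred nat) :
  transitive e ->
  cont e m [seq nth 0 w i | i <- iota 0 (size w) & Q i] <->
  exists A : {set 'I_(size w)},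
    [/\ mono (ordby (@slot w)) (relpre (@entry w) e) A, #|A| = m
      & {in A, forall i : 'I_(size w), Q i}].
Proof.
move=> tr; split.
  case=> v [/subseqP[b _ ->]]; rewrite -map_mask.
  (* The list [s] holds the chosen positions, in increasing order, rather than the values there. *)
  set s := mask b _ => sz sv.
  have ss : subseq s [seq i <- iota 0 (size w) | Q i] by apply: mask_subseq.
  have s_iota : subseq s (iota 0 (size w)).
    by apply: subseq_trans ss (filter_subseq _ _).
  have srt : sorted ltn s by exact: (subseq_sorted ltn_trans s_iota (iota_ltn_sorted _ _)).
  exists [set i : 'I_(size w) | val i \in s]; split.
  - apply/monoP => i j; rewrite !inE => si sj; rewrite /ordby /slot ltnS => ij.
    rewrite sorted_map in sv.
    apply: (@sorted_ltn_index _ (relpre (nth 0 w) e) _ s sv) => //.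
      by move=> ? ? ?; apply: tr.
    rewrite ltnNge leq_eqVlt; apply/negP => /orP[/eqP eqij|].
      by move: ij; rewrite -(nth_index 0 si) -eqij (nth_index 0 sj) ltnn.
    move=> /(sorted_ltn_index ltn_trans srt _ _ sj si) /= ji.
    by have := ltn_trans ij ji; rewrite ltnn.
  - rewrite -sz size_map cardE -(size_map val); apply/perm_size/uniq_perm.
    + by rewrite map_inj_uniq ?enum_uniq //; apply: val_inj.
    + exact: sorted_uniq ltn_trans ltnn _ srt.
    move=> x; apply/mapP/idP => [[i]|xs]; first by rewrite mem_enum inE => ? ->.
    have xn : x < size w by have := mem_subseq s_iota xs; rewrite mem_iota.
    by exists (Ordinal xn) => //; rewrite mem_enum inE.
  - move=> i; rewrite inE => /(mem_subseq ss); by rewrite mem_filter => /andP[].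
case=> A [/monoP mA cA QA].
exists [seq entry i | i <- enum A]; split.
- rewrite -[[seq entry i | i <- _]]/[seq (nth 0 w \o val) i | i <- enum A] (map_comp (nth 0 w)).
  apply: (@map_subseq _ _ (nth 0 w)); rewrite subseq_filter; apply/andP; split.
    by apply/allP => _ /mapP[i iA ->]; apply: QA; rewrite mem_enum in iA.
  by rewrite -val_enum_ord map_subseq // enumT filter_subseq.
- by rewrite size_map -cardE.
rewrite sorted_map.
apply: (@sub_in_sorted _ [in A] (ordby (@slot w))) => [i j iA jA||].
- exact: mA.
- by apply/allP => i; rewrite mem_enum.
have : sorted ltn [seq val i | i <- enum A].
  apply: (subseq_sorted ltn_trans _ (iota_ltn_sorted 0 (size w))).
  by rewrite -val_enum_ord map_subseq // enumT filter_subseq.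
by rewrite sorted_map.
Qed.

(** Take the least t such that some [A] in [P] stays below t. At t - 1 only the second alternative
    is left, and the [D] it yields is weakly above [A]. *)
Lemma threshold (T : finType) (P Q : pred {set T}) (g : T -> nat) n :
  (forall A, P A -> A != set0) -> (forall A, Q A -> A != set0) ->
  (forall i, 0 < g i <= n) ->
  (forall t, 1 <= t <= n.+1 ->
     (exists A, P A /\ {in A, forall i, g i < t}) \/
     (exists D, Q D /\ {in D, forall i, t <= g i})) <->
  exists A D, [/\ P A, Q D & below (ordby g) A D].
Proof.
move=> P0 Q0 gn; split=> [h|[A [D [PA QD /belowP b]]] t /andP[t0 tn]]; last first.
  (* If [A] does not stay below t, it has a point at level t or higher, and no point of [D] is below
     that one. *)
  have [|/forall_inPn[i iA]] := boolP [forall i in A, g i < t].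
    by move=> /forall_inP lt; left; exists A.
  rewrite -leqNgt => ti; right; exists D; split=> // j jD.
  by apply: leq_trans ti _; rewrite leqNgt; apply: b.
pose good t := [exists A, P A && [forall i in A, g i < t]].
have goodP t : reflect (exists A, P A /\ {in A, forall i, g i < t}) (good t).
  apply: (iffP existsP) => -[A] => [/andP[PA /forall_inP lt]|[PA lt]]; exists A.
    by [].
  by rewrite PA; apply/forall_inP.
(* At n + 1 the second alternative fails: [D] is nonempty and [g] is at most n. *)
have exg : exists t, good t.
  exists n.+1; have hn : 1 <= n.+1 <= n.+1 by lia.
  case: (h _ hn) => [?|[D [/Q0 D0 ge]]]; first exact/goodP.
  by case/set0Pn: D0 => i /ge; have := gn i; lia.
case: (ex_minnP exg) => t /goodP[A [PA ltA]] tmin.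
have t1 : 1 < t by case/set0Pn: (P0 _ PA) => i /ltA; have := gn i; lia.
have tn : t <= n.+1.
  apply: tmin; apply/goodP; exists A; split=> // i _; have := gn i; lia.
case: (h t.-1) => [||[D [QD geD]]]; first by lia.
  by move=> /goodP /tmin; lia.
exists A, D; split=> //; apply/belowP => i j /ltA ltt /geD; rewrite /ordby; lia.
Qed.

Lemma take_subword w t : 0 < t <= (size w).+1 ->
  take t.-1 w = [seq nth 0 w i | i <- iota 0 (size w) & i.+1 < t].
Proof.
move=> tn; rewrite -(map_nth_iota0 0); last by lia.
congr map; rewrite -(@filter_iota_ltn 0 (size w)); last by lia.
apply: eq_filter => i; lia.
Qed.

Lemma drop_subword w t : 0 < t <= (size w).+1 ->
  drop t.-1 w = [seq nth 0 w i | i <- iota 0 (size w) & t <= i.+1].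
Proof.
move=> tn; have <- : t.-1 + (size w - t.-1) = size w by lia.
rewrite iotaD filter_cat map_cat.
rewrite (_ : filter _ _ = [::]); last first.
  by apply/eqP; rewrite -[_ == _]negbK -has_filter; apply/hasPn => i; rewrite mem_iota; lia.
rewrite (_ : filter _ _ = iota (0 + t.-1) (size w - t.-1)); last first.
  by apply/all_filterP/allP => i; rewrite mem_iota; lia.
by rewrite add0n map_nth_iota // -size_drop take_size.
Qed.

Lemma filter_subword (P : pred nat) w :
  filter P w = [seq nth 0 w i | i <- iota 0 (size w) & P (nth 0 w i)].
Proof. by rewrite -{1}[w]take_size -(map_nth_iota0 0 (leqnn _)) filter_map. Qed.

Lemma cont_leq (e : rel nat) m m' w : m <= m' -> cont e m' w -> cont e m w.
Proof.
move=> mm' [v [vw sz sv]]; exists (take m v); split.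
- exact: subseq_trans (take_subseq _ _) vw.
- by rewrite size_takel // sz.
- exact: take_sorted.
Qed.

Lemma cont_bound (e : rel nat) m w :
  transitive e ->
  ~ cont e m.+1 w <->
  (forall A, mono (ordby (@slot w)) (relpre (@entry w) e) A -> #|A| <= m).
Proof.
move=> tr; have wE k : cont e k w = cont e k [seq nth 0 w i | i <- iota 0 (size w) & predT i].
  by rewrite filter_predT map_nth_iota0 // take_size.
split=> [h A mA|h].
  rewrite leqNgt; apply/negP => /cont_leq le; apply: h; apply: le.
  by rewrite wE; apply/(cont_subword _ _ _ tr); exists A; split.
rewrite wE => /(cont_subword _ _ _ tr)[A [/h le cA _]].
by rewrite cA ltnn in le.
Qed.

Lemma permutation_bounds w :
  is_permutation w -> uniq w /\ {in w, forall x, 0 < x <= size w}.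
Proof.
case=> _ pw; split; first by rewrite (perm_uniq pw) iota_uniq.
by move=> x; rewrite (perm_mem pw) mem_iota add1n.
Qed.

Lemma quadrocrucialP p q w :
  0 < p -> 0 < q -> is_permutation w ->
  quadrocrucial p.+1 q.+1 w <->
  config (ordby (@slot w)) (ordby (@entry w)) p q.
Proof.
move=> p0 q0 pw; have [uw bw] := permutation_bounds pw.
set x := ordby _; set y := ordby _.
pose P (A : {set 'I_(size w)}) := mono x y A && (#|A| == p).
pose Q (D : {set 'I_(size w)}) := mono x (conv y) D && (#|D| == q).
have tx := strict_total_slot w.
have ty := strict_total_entry uw.
have eP (R : pred nat) :
    cont ltn p [seq nth 0 w i | i <- iota 0 (size w) & R i] <->
    exists A, P A /\ {in A, forall i : 'I_(size w), R i}.
  split=> [/(cont_subword _ _ _ ltn_trans)[A [mA cA RA]]|[A [/andP[mA /eqP cA] RA]]].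
    by exists A; rewrite /P mA cA eqxx.
  by apply/(cont_subword _ _ _ ltn_trans); exists A.
have eQ (R : pred nat) :
    cont gtn q [seq nth 0 w i | i <- iota 0 (size w) & R i] <->
    exists A, Q A /\ {in A, forall i : 'I_(size w), R i}.
  split=> [/(cont_subword _ _ _ gtn_trans)[A [mA cA RA]]|[A [/andP[mA /eqP cA] RA]]].
    by exists A; rewrite /Q cA eqxx andbT.
  by apply/(cont_subword _ _ _ gtn_trans); exists A.
have P0 A : P A -> A != set0.
  by case/andP=> _ /eqP cA; rewrite -card_gt0 cA.
have Q0 A : Q A -> A != set0.
  by case/andP=> _ /eqP cA; rewrite -card_gt0 cA.
have ey i : 0 < @entry w i <= size w by apply: bw; apply: mem_nth.
have ex i : 0 < @slot w i <= size w by apply: ltn_ord.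
(* [T1] to [T4] treat the extensions to the right, to the left, from above and from below. *)
have T1 := threshold P0 Q0 ey; have T2 := threshold Q0 P0 ey.
have T3 := threshold P0 Q0 ex; have T4 := threshold Q0 P0 ex.
have cr z : crossing x y z p q <->
    (exists A D, [/\ P A, Q D & below z A D]) /\
    (exists D A, [/\ Q D, P A & below z D A]).
  split=> -[[A [D h1]] [A' [D' h2]]].
    by split; [exists A, D | exists D', A'];
      rewrite /P /Q; [case: h1 | case: h2] => -> -> -> -> ->; rewrite !eqxx.
  case: h1 => /andP[? /eqP ?] /andP[? /eqP ?] ?.
  by case: h2 => /andP[? /eqP ?] /andP[? /eqP ?] ?; split; [exists A, D | exists D', A'].
have R t := ext_rightP p q w t; have L t := ext_leftP p q w t.
have A t : _ := @ext_aboveP p q w t (fun x xw => proj2 (andP (bw x xw))).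
have B t : _ := @ext_belowP p q w t (fun x xw => proj1 (andP (bw x xw))).
have bp := cont_bound p w ltn_trans; have bq := cont_bound q w gtn_trans.
have key : ~ contains_either p.+1 q.+1 w ->
    (forall t, 1 <= t <= (size w).+1 ->
       [/\ contains_either p.+1 q.+1 (ext_right w t),
            contains_either p.+1 q.+1 (ext_left w t),
            contains_either p.+1 q.+1 (ext_above w t)
          & contains_either p.+1 q.+1 (ext_below w t)]) <->
    crossing x y y p q /\ crossing x y x p q.
  move=> nc.
  have R' t : contains_either p.+1 q.+1 (ext_right w t) <->
      (exists A, P A /\ {in A, forall i, entry i < t}) \/
      (exists D, Q D /\ {in D, forall i, t <= entry i}).
    have := R t; rewrite (filter_subword (fun x => x < t)) (filter_subword (leq t)).
    by have := eP (fun i => nth 0 w i < t); have := eQ (fun i => t <= nth 0 w i); tauto.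
  have L' t : contains_either p.+1 q.+1 (ext_left w t) <->
      (exists D, Q D /\ {in D, forall i, entry i < t}) \/
      (exists A, P A /\ {in A, forall i, t <= entry i}).
    have := L t; rewrite (filter_subword (fun x => x < t)) (filter_subword (leq t)).
    by have := eQ (fun i => nth 0 w i < t); have := eP (fun i => t <= nth 0 w i); tauto.
  have A' t : 1 <= t <= (size w).+1 -> contains_either p.+1 q.+1 (ext_above w t) <->
      (exists A, P A /\ {in A, forall i, slot i < t}) \/
      (exists D, Q D /\ {in D, forall i, t <= slot i}).
    move=> ht; have := A t; rewrite take_subword // drop_subword //.
    by have := eP (fun i => i.+1 < t); have := eQ (fun i => t <= i.+1); tauto.
  have B' t : 1 <= t <= (size w).+1 -> contains_either p.+1 q.+1 (ext_below w t) <->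
      (exists D, Q D /\ {in D, forall i, slot i < t}) \/
      (exists A, P A /\ {in A, forall i, t <= slot i}).
    move=> ht; have := B t; rewrite take_subword // drop_subword //.
    by have := eQ (fun i => i.+1 < t); have := eP (fun i => t <= i.+1); tauto.
  have c1 := cr y; have c2 := cr x.
  split=> [h|[/c1[/T1 h1 /T2 h2] /c2[/T3 h3 /T4 h4]] t ht].
    split; [apply/c1|apply/c2]; split; [apply/T1|apply/T2|apply/T3|apply/T4];
    by move=> t ht; case: (h t ht) => /R' ? /L' ? /(A' t ht) ? /(B' t ht).
  split.
  - by apply/R'; apply: h1.
  - by apply/L'; apply: h2.
  - by apply/(A' t ht); apply: h3.
  - by apply/(B' t ht); apply: h4.
split=> [[_ n1 n2 h]|[_ m1 m2 c1 c2]].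
  have nc : ~ contains_either p.+1 q.+1 w by case.
  have [c1 c2] := proj1 (key nc) h.
  by split=> //; [apply/bp | apply/bq].
have n1 : ~ contains_incr p.+1 w by apply/bp.
have n2 : ~ contains_decr q.+1 w by apply/bq.
split=> //; have nc : ~ contains_either p.+1 q.+1 w by case.
by apply/(key nc).
Qed.

(** * Reversal, and recovery of a permutation from its comparisons *)

Lemma is_permutation_rev w : is_permutation w -> is_permutation (rev w).
Proof. by case=> w0 pw; split; rewrite size_rev // perm_rev. Qed.

Lemma contains_either_rev k l w :
  contains_either k l w -> contains_either l k (rev w).
Proof. by case=> h; [right|left]; apply/cont_rev. Qed.

Lemma quadrocrucial_rev k l w : quadrocrucial k l w -> quadrocrucial l k (rev w).
Proof.
case=> pw n1 n2 h; split; first exact: is_permutation_rev.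
- by move/cont_rev.
- by move/cont_rev.
move=> t; rewrite size_rev => ht.
(* Reversal exchanges left and right at the same t; above and below are kept, with insertion place n
   + 2 - t. *)
have h1 := h t ht; have h2 := h ((size w).+2 - t) ltac:(lia).
have e : ((size w).+2 - t).-1 = size w - t.-1 by lia.
split.
- rewrite (_ : ext_right _ _ = rev (ext_left w t)).
    by apply: contains_either_rev; case: h1.
  by rewrite /ext_left /ext_right rev_cons map_rev.
- rewrite (_ : ext_left _ _ = rev (ext_right w t)).
    by apply: contains_either_rev; case: h1.
  by rewrite /ext_left /ext_right rev_rcons map_rev.
- rewrite (_ : ext_above _ _ = rev (ext_above w ((size w).+2 - t))).
    by apply: contains_either_rev; case: h2.
  by rewrite /ext_above rev_cat rev_cons cat_rcons size_rev e take_rev drop_rev.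
- rewrite (_ : ext_below _ _ = rev (ext_below w ((size w).+2 - t))).
    by apply: contains_either_rev; case: h2.
  by rewrite /ext_below rev_cat rev_cons cat_rcons e take_rev drop_rev !map_rev.
Qed.

Lemma minimal_quadrocrucial_rev k l w :
  minimal_quadrocrucial k l (rev w) <-> minimal_quadrocrucial l k w.
Proof.
split=> -[qw mw]; split.
- by rewrite -(revK w); apply: quadrocrucial_rev.
- by move=> v /quadrocrucial_rev /mw; rewrite !size_rev.
- exact: quadrocrucial_rev.
- by move=> v /quadrocrucial_rev /mw; rewrite !size_rev.
Qed.

(** The values below an entry v are 1, ..., v - 1, each taken once. Thus the comparisons determine
    the entries. *)
Lemma permutation_entry w i : is_permutation w -> i < size w ->
  nth 0 w i = (count (fun j => nth 0 w j < nth 0 w i) (iota 0 (size w))).+1.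
Proof.
move=> pw iw; have [_ bw] := permutation_bounds pw.
have /bw b : nth 0 w i \in w by apply: mem_nth.
rewrite -[RHS](congr1 S (count_map (nth 0 w) (fun x => x < nth 0 w i) _)).
rewrite map_nth_iota0 // take_size.
have [_ /permP ->] := pw; rewrite -size_filter.
have -> : nth 0 w i = 1 + (nth 0 w i).-1 by lia.
rewrite filter_iota_ltn; last by lia.
by rewrite size_iota.
Qed.

Lemma permutation_eq u v :
  is_permutation u -> is_permutation v -> size u = size v ->
  (forall i j, i < size u -> j < size u ->
     (nth 0 u i < nth 0 u j) = (nth 0 v i < nth 0 v j)) ->
  u = v.
Proof.
move=> pu pv suv h; apply: (@eq_from_nth _ 0) => // i iu.
rewrite (permutation_entry pu) // (permutation_entry pv) -?suv //.
by congr S; apply: eq_in_count => j; rewrite mem_iota => /andP[_ ju]; apply: h.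
Qed.

(** * The extremal permutation *)

(* Positions are counted from 0; the middle block has r = p - 2 entries. *)
Definition wave (q r i : nat) : nat :=
  if i < q then q - i else if i < q + r then i.+1 else 3 * q + 2 * r - i.

Definition wave_word (q r : nat) : seq nat := mkseq (wave q r) (2 * q + r).

(** The first two disjuncts compare different blocks, the other three compare positions inside the
    first, middle and last block. *)
Lemma wave_lt q r i j : i < 2 * q + r -> j < 2 * q + r ->
  (wave q r i < wave q r j) =
  [|| (i < q) && (q <= j), (i < q + r) && (q + r <= j),
      [&& i < q, j < q & j < i], [&& q <= i, j < q + r & i < j]
    | [&& q + r <= i, q + r <= j & j < i]].
Proof.
rewrite /wave => i_n j_n.
case: (ltnP i q) (ltnP j q) (ltnP i (q + r)) (ltnP j (q + r)) => ? [] ? [] ? [] ?; lia.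
Qed.

(** The word is invariant under a half turn, so its reversal is also its complement. *)
Lemma wave_rev q r i : i < 2 * q + r ->
  wave q r (2 * q + r - i.+1) = (2 * q + r).+1 - wave q r i.
Proof.
rewrite /wave => i_n.
case: (ltnP i q) (ltnP i (q + r)) => ? [] ?;
case: (ltnP (2 * q + r - i.+1) q) => ?;
case: (ltnP (2 * q + r - i.+1) (q + r)) => ?; lia.
Qed.

Lemma wave_bounds q r i : i < 2 * q + r -> 0 < wave q r i <= 2 * q + r.
Proof.
rewrite /wave => i_n; case: (ltnP i q) (ltnP i (q + r)) => ? [] ?; lia.
Qed.

Lemma wave_permutation q r : 0 < q -> is_permutation (wave_word q r).
Proof.
move=> q0; rewrite /is_permutation size_mkseq; split; first lia.
have inj : {in iota 0 (2 * q + r) &, injective (wave q r)}.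
  move=> i j; rewrite !mem_iota /= => i_n j_n eij.
  (* With equal values all disjuncts of [wave_lt] fail in both directions, which leaves only i =
     j. *)
  have := wave_lt i_n j_n; have := wave_lt j_n i_n; rewrite eij ltnn; lia.
have u : uniq (wave_word q r) by rewrite map_inj_in_uniq ?iota_uniq.
have sub : {subset wave_word q r <= iota 1 (2 * q + r)}.
  move=> x /mapP[i]; rewrite mem_iota /= => i_n ->.
  rewrite mem_iota; have := wave_bounds i_n; lia.
have [_ eqi] := uniq_min_size u sub ltac:(rewrite size_iota size_mkseq; lia).
by apply: uniq_perm => //; apply: iota_uniq.
Qed.

Lemma card_segment n a b : a <= b <= n -> #|[set i : 'I_n | a <= i < b]| = b - a.
Proof.
move=> ab.
have -> : [set i : 'I_n | a <= i < b] = [set i : 'I_n | i < b] :\: [set i : 'I_n | i < a].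
  by apply/setP => i; rewrite !inE -leqNgt andbC.
have c m : m <= n -> #|[set i : 'I_n | i < m]| = m.
  move=> mn; have inj : injective (widen_ord mn) by move=> i j [] /val_inj.
  rewrite -[RHS]card_ord -cardsT -(card_imset _ inj); apply: eq_card => i.
  rewrite inE; apply/idP/imsetP => [im|[j _ ->]]; last exact: (ltn_ord j).
  by exists (Ordinal im) => //; apply: val_inj.
rewrite cardsD (setIidPr _) ?c //; try lia.
by apply/subsetP => i; rewrite !inE; lia.
Qed.

Lemma initial_segment n (A : {set 'I_n}) :
  (forall i j : 'I_n, i < j -> j \in A -> i \in A) ->
  forall i : 'I_n, (i \in A) = (i < #|A|).
Proof.
move=> dA i; apply/idP/idP => [iA|].
  have : [set j : 'I_n | 0 <= j < i.+1] \subset A.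
    apply/subsetP => j; rewrite inE ltnS /= leq_eqVlt => /orP[/eqP /val_inj -> //|ji].
    exact: dA ji iA.
  by move/subset_leq_card; rewrite card_segment ?subn0 //= ltn_ord.
apply: contraTT => iA; rewrite -leqNgt.
have : A \subset [set j : 'I_n | 0 <= j < i].
  apply/subsetP => j jA; rewrite inE /= ltnNge leq_eqVlt.
  by apply: contraNN iA => /orP[/eqP /val_inj -> //|/dA]; apply.
by move/subset_leq_card; rewrite card_segment ?subn0 //= ltnW.
Qed.

(** An increasing chain has at most one point in each decreasing block besides the r middle ones. A
    decreasing chain stays in one block, and in the middle block it is a single point. *)
Lemma wave_config q r : 0 < q ->
  config (ordby (@slot (wave_word q r))) (ordby (@entry (wave_word q r))) r.+2 q.
Proof.
move=> q0; set w := wave_word q r; set x := ordby _; set y := ordby _.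
have sw : size w = 2 * q + r by apply: size_mkseq.
have bnd (i : 'I_(size w)) : i < 2 * q + r by rewrite -sw.
have yE i j : y i j = (wave q r i < wave q r j).
  by rewrite /y /ordby /entry !nth_mkseq.
have [uw _] := permutation_bounds (wave_permutation r q0).
have tx := strict_total_slot w.
have ty := strict_total_entry uw.
pose D1 := [set i : 'I_(size w) | q + r <= i < 2 * q + r].
pose D2 := [set i : 'I_(size w) | 0 <= i < q].
pose M := [set i : 'I_(size w) | q <= i < q + r].
have c1 : #|D1| = q by rewrite card_segment; lia.
have c2 : #|D2| = q by rewrite card_segment; lia.
have cM : #|M| = r by rewrite card_segment; lia.
have m1 : mono x (conv y) D1.
  apply/monoP => i j; rewrite !inE /x /ordby /slot /conv yE wave_lt //; lia.
have m2 : mono x (conv y) D2.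
  apply/monoP => i j; rewrite !inE /x /ordby /slot /conv yE wave_lt //; lia.
have ex a : a < 2 * q + r -> exists i : 'I_(size w), val i = a.
  by rewrite -sw => an; exists (Ordinal an).
(* The middle block with one point of each decreasing block added is an increasing chain of length r
   + 2. *)
have chain a b : a < q -> q + r <= b < 2 * q + r ->
    exists I : {set 'I_(size w)}, [/\ mono x y I, #|I| = r.+2
      & {in I, forall i : 'I_(size w), [|| i == a :> nat, q <= i < q + r | i == b :> nat]}].
  move=> aq /andP[qb bn]; have [i ia] := ex a ltac:(lia); have [j jb] := ex b bn.
  exists (i |: (j |: M)); split.
  - apply/monoP => k l; rewrite !inE -!val_eqE ia jb /x /ordby /slot yE wave_lt //=; lia.
  - rewrite !cardsU1 !inE -!val_eqE ia jb cM; move: (ia) (jb) => /=; lia.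
  - by move=> k; rewrite !inE -!val_eqE ia jb /=; lia.
split=> //.
- move=> A mA.
  have := card_mono_conv tx ty mA m1; have := card_mono_conv tx ty mA m2.
  have : A \subset (A :&: D1) :|: ((A :&: D2) :|: M).
    by apply/subsetP => i iA; rewrite !inE iA; have := bnd i; lia.
  move/subset_leq_card; rewrite cardsU (cardsU _ M) cM; lia.
- move=> A /monoP mA.
  have [->|/set0Pn[a aA]] := eqVneq A set0; first by rewrite cards0.
  have key b : b \in A -> (a < q) = (b < q) /\ (q + r <= a) = (q + r <= b)
      /\ (q <= a < q + r -> a = b).
    move=> bA; have := mA _ _ aA bA; have := mA _ _ bA aA.
    rewrite /x /ordby /slot /conv !yE !wave_lt // => h1 h2.
    split; first lia. split; first lia.
    by move=> ?; apply: val_inj => /=; lia.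
  have [aq|qa] := ltnP a q.
    rewrite -c2; apply/subset_leq_card/subsetP => b /key; rewrite inE; lia.
  have [aq|qra] := ltnP a (q + r).
    have : A \subset [set a].
      by apply/subsetP => b /key[_ [_ ->]]; rewrite ?inE //; lia.
    by move/subset_leq_card; rewrite cards1; lia.
  rewrite -c1; apply/subset_leq_card/subsetP => b /key; rewrite inE; have := bnd b; lia.
(* The first position carries the top of [D2], the last one the bottom of [D1]. *)
- have [I [mI cI hI]] := chain 0 (2 * q + r).-1 ltac:(lia) ltac:(lia).
  split; [exists I, D1 | exists I, D2]; split=> //; apply/belowP => i j.
    move=> /hI hi; rewrite inE => hj; rewrite yE wave_lt //; lia.
  move=> hi /hI hj; move: hi; rewrite inE => hi; rewrite yE wave_lt //; lia.
(* These are the rightmost point of [D2] and the leftmost of [D1]. *)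
- have [I [mI cI hI]] := chain q.-1 (q + r) ltac:(lia) ltac:(lia).
  split; [exists I, D1 | exists I, D2]; split=> //; apply/belowP => i j.
    move=> /hI hi; rewrite inE => hj; rewrite /x /ordby /slot; lia.
  move=> hi /hI hj; move: hi; rewrite inE => hi; rewrite /x /ordby /slot; lia.
Qed.

(** [D2] and the complement of [D1] are closed downwards in position, so their sizes fix them as
    initial segments, and the layout then decides every comparison. *)
Lemma layout_wave n (y : rel 'I_n) (q r : nat) :
  n = 2 * q + r -> strict_total y ->
  layout (fun i j : 'I_n => i < j) y q ->
  forall i j, y i j = (wave q r i < wave q r j).
Proof.
move=> nE ty [D1 [D2 [[m1 c1 m2 c2] mM [x1 x2 x3] [y1 y2 y3]]]].
set M := ~: _ in mM x1 x2 y1 y2.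
have D12 : [disjoint D1 & D2].
  by apply/pred0P => i /=; apply/negP => /andP[i1 i2]; have := x3 _ _ i2 i1; rewrite ltnn.
have cU : #|D1 :|: D2| = 2 * q.
  by rewrite cardsU (eqP (_ : D1 :&: D2 == set0)) ?setI_eq0 // cards0; lia.
have cases i : [\/ i \in D1, i \in D2 | i \in M].
  have [iM|] := boolP (i \in M); first by constructor 3.
  by rewrite inE negbK => /setUP[]; [constructor 1 | constructor 2].
have inD2 i : (i \in D2) = (i < q).
  rewrite -c2; apply: initial_segment => {}i j ij jD.
  by case: (cases i) => // h; [have := x3 _ _ jD h | have := x1 _ _ jD h]; lia.
have inD1 i : (i \in D1) = (q + r <= i).
  have cC := cardsC D1; rewrite card_ord in cC.
  rewrite -[LHS]negbK -in_setC leqNgt; congr negb.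
  have -> : q + r = #|~: D1| by lia.
  apply: initial_segment => {}i j ij; rewrite !inE; apply: contraNN => iD.
  by case: (cases j) => // h; [have := x3 _ _ h iD | have := x2 _ _ h iD]; lia.
have inM i : (i \in M) = (q <= i < q + r).
  by rewrite !inE inD1 inD2; lia.
have wave_y (i j : 'I_n) : wave q r i < wave q r j -> y i j.
  rewrite wave_lt -?nE //.
  case/or4P=> [/andP[iq qj]|/andP[iq qj]|/and3P[iq jq ji]|/orP[]/and3P[h1 h2 h3]].
  - have iD : i \in D2 by rewrite inD2.
    have [jr|rj] := ltnP j (q + r); first by apply: y1; rewrite // inM qj.
    by apply: y3; rewrite // inD1.
  - have jD : j \in D1 by rewrite inD1.
    have [iq'|qi] := ltnP i q; first by apply: y3; rewrite // inD2.
    by apply: y2; rewrite // inM qi.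
  - by apply: (monoP _ _ _ m2 j i); rewrite // inD2.
  - by apply: (monoP _ _ _ mM i j); rewrite // inM; lia.
  - by apply: (monoP _ _ _ m1 j i); rewrite // inD1.
(* The converse follows since distinct positions are comparable on both sides. *)
move=> i j; apply/idP/idP; last exact: wave_y.
apply: contraLR => nij; apply/negP => yij.
have [ij|ij] := eqVneq i j; first by case: ty => irr _ _; rewrite ij irr in yij.
apply: (strict_asym ty yij); apply: wave_y; move: nij ij.
by rewrite !wave_lt -?nE // -val_eqE /=; lia.
Qed.

Lemma layout_wave_word (w : seq nat) q r :
  0 < q -> is_permutation w -> size w = 2 * q + r ->
  layout (ordby (@slot w)) (ordby (@entry w)) q -> w = wave_word q r.
Proof.
move=> q0 pw sw lw; have [uw _] := permutation_bounds pw.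
have ty := strict_total_entry uw.
(* [ordby (@slot w)] compares successors of positions, which is convertible with comparing the
   positions. *)
have yE := layout_wave sw ty lw.
apply: permutation_eq => //; [exact: wave_permutation | by rewrite size_mkseq |].
move=> i j iw jw; rewrite !nth_mkseq -?sw //.
exact: yE (Ordinal iw) (Ordinal jw).
Qed.

Lemma layout_conv_wave_word (w : seq nat) q r :
  0 < q -> is_permutation w -> size w = 2 * q + r ->
  layout (ordby (@slot w)) (conv (ordby (@entry w))) q -> w = rev (wave_word q r).
Proof.
move=> q0 pw sw lw; have [uw _] := permutation_bounds pw.
have ty := strict_total_entry uw.
have yE := layout_wave sw (strict_total_conv ty) lw.
apply: permutation_eq => //.
- exact/is_permutation_rev/wave_permutation.
- by rewrite size_rev size_mkseq.
move=> i j iw jw; rewrite !nth_rev ?size_mkseq -?sw //.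
rewrite !nth_mkseq; try lia.
rewrite sw in iw jw *; rewrite !wave_rev //.
have := yE (Ordinal (eq_ind_r (fun n => j < n) jw sw)) (Ordinal (eq_ind_r (fun n => i < n) iw sw)).
rewrite /conv /ordby /entry /= => ->.
have := wave_bounds iw; have := wave_bounds jw; lia.
Qed.

(** * Minimal length and the minimal permutations for p > 2 *)

Lemma quadrocrucial_size p q w :
  1 < q <= p -> quadrocrucial p.+1 q.+1 w -> p + 2 * q <= size w + 2.
Proof.
move=> qp qw; have [pw _ _ _] := qw.
have [p0 q0] : 0 < p /\ 0 < q by lia.
have cf := proj1 (quadrocrucialP p0 q0 pw) qw.
by have := config_leq cf qp; rewrite card_ord.
Qed.

Lemma wave_quadrocrucial q r : 0 < q -> quadrocrucial r.+3 q.+1 (wave_word q r).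
Proof.
move=> q0; apply/quadrocrucialP => //; first exact: wave_permutation.
exact: wave_config.
Qed.

(** The wave word attains the lower bound on the size, so every minimal permutation is in the case
    of equality of [config_layout]. *)
Lemma minimal_quadrocrucialE p q w :
  1 < q <= p -> 2 < p ->
  minimal_quadrocrucial p.+1 q.+1 w <->
  w = wave_word q p.-2 \/ p = q /\ w = rev (wave_word q p.-2).
Proof.
move=> qp p2; have q0 : 0 < q by lia.
have pE : p = p.-2.+2 by lia.
have wq := wave_quadrocrucial p.-2 q0; rewrite -pE in wq.
have min_wave : minimal_quadrocrucial p.+1 q.+1 (wave_word q p.-2).
  split=> // v /(quadrocrucial_size qp); rewrite size_mkseq; lia.
split=> [[qw mw]|[->|[epq ->]]]; last 2 first.
- exact: min_wave.
- by subst q; apply/minimal_quadrocrucial_rev.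
have sw : size w = 2 * q + p.-2.
  have := mw _ wq; have := quadrocrucial_size qp qw; rewrite size_mkseq; lia.
have [pw _ _ _] := qw.
have cf : config (ordby (@slot w)) (ordby (@entry w)) p q.
  by apply/quadrocrucialP => //; lia.
have cT : p + 2 * q = #|'I_(size w)| + 2 by rewrite card_ord; lia.
have [l|[epq l]] := config_layout cf qp p2 cT.
- by left; apply: layout_wave_word.
- by right; split=> //; apply: layout_conv_wave_word.
Qed.

(** * The case k = l = 3 *)

Fixpoint subwords (w : seq nat) : seq (seq nat) :=
  if w is x :: w' then subwords w' ++ map (cons x) (subwords w') else [:: [::]].

Lemma mem_subwords v w : (v \in subwords w) = subseq v w.
Proof.
elim: w v => [|x w IH] v /=; first by rewrite inE; case: v.
rewrite mem_cat IH; case: v => [|y v]; first by rewrite sub0seq.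
have -> : (y :: v \in map (cons x) (subwords w)) = (y == x) && subseq v w.
  apply/mapP/andP => [[u uw [-> ->]]|[/eqP -> vw]]; last by exists v; rewrite ?IH.
  by rewrite eqxx -IH.
have [_|_] := eqVneq y x; last by rewrite orbF.
apply/orP/idP => [[/(subseq_trans (subseq_cons v y))|]|vw] //; by right.
Qed.

Definition contb (e : rel nat) (m : nat) (w : seq nat) : bool :=
  has (fun v => (size v == m) && sorted e v) (subwords w).

Lemma contP (e : rel nat) m w : reflect (cont e m w) (contb e m w).
Proof.
apply: (iffP hasP) => [[v]|[v [vw sz sv]]].
  by rewrite mem_subwords => vw /andP[/eqP sz sv]; exists v.
by exists v; rewrite ?mem_subwords // sz eqxx.
Qed.

Definition quadb (k l : nat) (w : seq nat) : bool :=
  let cb u := contb ltn k u || contb gtn l u in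
  ~~ cb w && all (fun t => [&& cb (ext_right w t), cb (ext_left w t),
                            cb (ext_above w t) & cb (ext_below w t)])
                 (iota 1 (size w).+1).

Lemma quadP k l w : is_permutation w -> reflect (quadrocrucial k l w) (quadb k l w).
Proof.
move=> pw.
have cbP u : reflect (contains_either k l u) (contb ltn k u || contb gtn l u).
  by apply: (iffP orP) => -[] /contP; [left|right|left|right].
apply: (iffP andP) => [[/cbP nw /allP h]|[_ n1 n2 h]].
  split=> // [c|c|t ht]; [by apply: nw; left|by apply: nw; right|].
  have /h /and4P[/cbP ? /cbP ? /cbP ? /cbP ?] // : t \in iota 1 (size w).+1.
  by rewrite mem_iota.
split; first by apply/cbP => -[].
apply/allP => t; rewrite mem_iota => /h[? ? ? ?].
by apply/and4P; split; apply/cbP.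
Qed.

(** For p = q = 2 the rigidity argument does not apply, but the lower bound still gives length at
    least 4. It is attained, and the 24 permutations of that length are checked by computation. *)
Lemma minimal_quadrocrucial33 w :
  minimal_quadrocrucial 3 3 w <->
  w \in [:: [:: 2; 1; 4; 3]; [:: 3; 4; 1; 2]; [:: 2; 4; 1; 3]; [:: 3; 1; 4; 2]].
Proof.
set L := [:: _; _; _; _].
have enum4 : all (fun u => quadb 3 3 u == (u \in L)) (permutations (iota 1 4)).
  by vm_compute.
have L4 : all (fun u => u \in permutations (iota 1 4)) L by vm_compute.
have permE u : u \in permutations (iota 1 4) -> is_permutation u /\ size u = 4.
  by rewrite mem_permutations => pu; have su := perm_size pu; rewrite /is_permutation su.
have quadL u : u \in L -> quadrocrucial 3 3 u /\ size u = 4.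
  move=> uL; have pu := allP L4 _ uL; have [pu' su] := permE _ pu; split=> //.
  by apply/quadP => //; rewrite (eqP (allP enum4 _ pu)).
have lower u : quadrocrucial 3 3 u -> 4 <= size u.
  by move/(@quadrocrucial_size 2 2); lia.
split=> [[qw mw]|/quadL[qw sw]]; last first.
  by split=> // v /lower; rewrite sw; lia.
have [qv sv] := quadL [:: 2; 1; 4; 3] isT.
have sw : size w = 4 by have := lower _ qw; have := mw _ qv; rewrite sv; lia.
have [pw _ _ _] := qw.
have pw4 : w \in permutations (iota 1 4).
  by rewrite mem_permutations -sw; case: pw.
by rewrite -(eqP (allP enum4 _ pw4)); apply/quadP.
Qed.

(** * Counting the minimal permutations *)

Lemma minimal_quadrocrucial_neq p q :
  1 < q < p -> forall w, minimal_quadrocrucial p.+1 q.+1 w <-> w = wave_word q p.-2.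
Proof.
move=> qp w; have h := @minimal_quadrocrucialE p q w ltac:(lia) ltac:(lia).
split=> [/h[//|[]]|e]; first lia.
by apply/h; left.
Qed.

Lemma exactly1 (P : seq nat -> Prop) u : (forall w, P w <-> w = u) -> exactly 1 P.
Proof.
move=> h; exists [:: u]; split=> // w; rewrite inE.
by split=> [/eqP /h|/h /eqP].
Qed.

Theorem theorem37 :
  [/\ forall k : nat, 3 < k ->
        exists! w : seq nat, minimal_quadrocrucial k 3 w,
      exactly 4 (minimal_quadrocrucial 3 3)
    & forall k l : nat, 3 < k -> 3 < l ->
        exactly (1 + (k == l)) (minimal_quadrocrucial k l)].
Proof.
split.
- case=> // p p2; have h := @minimal_quadrocrucial_neq p 2 ltac:(lia).
  by exists (wave_word 2 p.-2); split=> [|w /h //]; apply/h.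
- exists [:: [:: 2; 1; 4; 3]; [:: 3; 4; 1; 2]; [:: 2; 4; 1; 3]; [:: 3; 1; 4; 2]].
  by split=> // w; rewrite minimal_quadrocrucial33.
case=> // p [//|q]; rewrite !ltnS eqSS => p2 q2.
have [qp|pq|eqp] := ltngtP q p; last subst q.
- by apply: exactly1; apply: minimal_quadrocrucial_neq; lia.
(* For p < q reversal exchanges k and l and reduces to the previous case. *)
- apply: (@exactly1 _ (rev (wave_word p q.-2))) => w.
  have h := @minimal_quadrocrucial_neq q p ltac:(lia) (rev w).
  have h' := minimal_quadrocrucial_rev q.+1 p.+1 w.
  split=> [/h'/h <-|->]; first by rewrite revK.
  apply/minimal_quadrocrucial_rev.
  by apply/(@minimal_quadrocrucial_neq q p ltac:(lia)).
exists [:: wave_word p p.-2; rev (wave_word p p.-2)]; split=> //.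
(* The word and its reversal differ in the first entry, which is p for one and 2p - 1 for the
   other. *)
- rewrite /= inE andbT; apply/eqP => /(congr1 (nth 0 ^~ 0)).
  rewrite nth_rev ?size_mkseq ?nth_mkseq; try lia.
  rewrite wave_rev; last lia.
  by rewrite /wave; case: ltnP; lia.
move=> w; rewrite !inE.
have h := @minimal_quadrocrucialE p p w ltac:(lia) ltac:(lia).
split=> [/orP[]/eqP e|/h[->|[_ ->]]]; rewrite ?eqxx ?orbT //; apply/h; by [left|right].
Qed.
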